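(* Let $Q$ and $Q'$ be quandles and let $\phi: Q \to Q'$ be a quandle homomorphism. Then a derived quandle $(\mathcal{A}_\phi,\partial)$ of $\phi$ exists, and it is unique up to isomorphism.
   Context: A quandle is a non-empty set $Q$ with a binary operation $*$ such that (Q1) $q*q=q$ for all $q$; (Q2) for all $q_1,q_2\in Q$ there is a unique $q\in Q$ with $q_2=q*q_1$; (Q3) $(q_1*q_2)*q_3=(q_1*q_3)*(q_2*q_3)$ for all $q_1,q_2,q_3$. A quandle homomorphism is a map $f$ with $f(q_1*q_2)=f(q_1)*f(q_2)$; $\operatorname{Aut}(A)$ is the group of quandle automorphisms of $A$. The associated group $\operatorname{As}(Q)$ is the group generated by $\{e_q \mid q\in Q\}$ modulo the relations $e_{q_1*q_2}=e_{q_2}e_{q_1}e_{q_2}^{-1}$. A quandle homomorphism $\phi:Q\to Q'$ induces a group homomorphism $\phi:\operatorname{As}(Q)\to\operatorname{As}(Q')$, $\phi(e_q)=e_{\phi(q)}$. A quandle $A$ is a $Q'$-quandle if it is equipped with a (left) action $(g,a)\mapsto g\cdot a$ of $\operatorname{As}(Q')$ on $A$ by quandle automorphisms. A $Q'$-homomorphism between $Q'$-quandles is a quandle homomorphism $f$ with $f(g\cdot a)=g\cdot f(a)$ for all $g\in \operatorname{As}(Q')$ and all $a$. Given a quandle homomorphism $\phi:Q\to Q'$ and a $Q'$-quandle $A$, a map $\partial:Q\to A$ is a derivation if $\partial(q_1*q_2)=\partial(q_1)*\big(\phi(e_{q_1})\cdot\partial(q_2)\big)$ for all $q_1,q_2\in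 Q$. A derived quandle of $\phi$ is a $Q'$-quandle $\mathcal{A}_\phi$ together with a derivation $\partial:Q\to\mathcal{A}_\phi$ such that for every $Q'$-quandle $A$ and every derivation $\partial':Q\to A$ there exists a unique $Q'$-homomorphism $\lambda:\mathcal{A}_\phi\to A$ with $\lambda\circ\partial=\partial'$. An isomorphism between two derived quandles $(\mathcal{A},\partial)$ and $(\mathcal{A}',\partial')$ of $\phi$ is a bijective $Q'$-homomorphism $\lambda:\mathcal{A}\to\mathcal{A}'$ with $\lambda\circ\partial=\partial'$. *)

(* Defs.v *)
From HB Require Import structures.
From mathcomp Require Import all_boot.
From mathcomp Require Import boolp.

Set Implicit Arguments.
Unset Strict Implicit.
Unset Printing Implicit Defensive.

Local Open Scope quotient_scope.

Declare Scope quandle_scope.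
Delimit Scope quandle_scope with quandle.

HB.mixin Record isQuandle (Q : Type) := {
  quandle_inhabited : inhabited Q;
  qmul : Q -> Q -> Q;
  qmulqq : forall q, qmul q q = q;
  qmul_div : forall q1 q2, exists! q, q2 = qmul q q1;
  qmul_distr : forall q1 q2 q3,
    qmul (qmul q1 q2) q3 = qmul (qmul q1 q3) (qmul q2 q3)
}.

#[short(type="quandleType")]
HB.structure Definition Quandle := {Q of isQuandle Q}.

Notation "x * y" := (qmul x y) : quandle_scope.

Definition quandle_morphism (Q Q' : quandleType) (f : Q -> Q') : Prop :=
  forall q1 q2, f (q1 * q2)%quandle = (f q1 * f q2)%quandle.

HB.mixin Record isQuandleHom (Q Q' : quandleType) (f : Q -> Q') := {
  quandle_homM : quandle_morphism f
}.

HB.structure Definition QuandleHom (Q Q' : quandleType) :=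
  {f of isQuandleHom Q Q' f}.

Notation "{ 'quandle_hom' Q -> Q' }" := (QuandleHom.type Q%type Q'%type)
  (at level 0, Q at level 98, Q' at level 99,
   format "{ 'quandle_hom'  Q  ->  Q' }") : type_scope.

Definition quandle_automorphism (A : quandleType) (f : A -> A) : Prop :=
  quandle_morphism f /\ bijective f.

(* As(Q) is the quotient of the words in the letters (q, true), standing for  *)
(* e_q, and (q, false), standing for e_q^-1, by the congruence below.         *)
Section AssociatedGroup.
Variable Q : quandleType.

Definition word := {classic seq (Q * bool)}.
HB.instance Definition _ := Choice.on word.

Inductive as_rel : word -> word -> Prop :=
| as_refl u : as_rel u u
| as_sym u v : as_rel u v -> as_rel v u
| as_trans u v w : as_rel u v -> as_rel v w -> as_rel u w
| as_cat u u' v v' : as_rel u u' -> as_rel v v' -> as_rel (u ++ v) (u' ++ v')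
| as_cancel q b : as_rel [:: (q, b); (q, ~~ b)] [::]
| as_conj q1 q2 :
    as_rel [:: ((q1 * q2)%quandle, true)]
           [:: (q2, true); (q1, true); (q2, false)].

Definition as_relb : rel word := fun u v => `[< as_rel u v >].

Lemma as_relb_refl : reflexive as_relb.
Proof. by move=> u; apply/asboolP; apply: as_refl. Qed.

Lemma as_relb_sym : symmetric as_relb.
Proof. by move=> u v; apply/asboolP/asboolP; apply: as_sym. Qed.

Lemma as_relb_trans : transitive as_relb.
Proof.
move=> v u w /asboolP uv /asboolP vw; apply/asboolP.
exact: as_trans uv vw.
Qed.

Canonical as_equiv :=
  EquivRel as_relb as_relb_refl as_relb_sym as_relb_trans.

Definition As := {eq_quot as_equiv}.
HB.instance Definition _ := Choice.on As.
HB.instance Definition _ := EqQuotient.on As.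

Definition as_class (w : word) : As := \pi_As w.

Lemma as_classP u v : as_class u = as_class v <-> as_rel u v.
Proof.
split=> [/eqmodP/asboolP //|uv].
by apply/eqmodP/asboolP.
Qed.

Lemma as_class_repr (x : As) : as_class (repr x) = x.
Proof. exact: reprK. Qed.

Lemma as_rel_repr w : as_rel (repr (as_class w)) w.
Proof. by apply/as_classP; rewrite as_class_repr. Qed.

Definition word_inv (w : word) : word := rev [seq (l.1, ~~ l.2) | l <- w].

Lemma word_invK : involutive word_inv.
Proof.
move=> w; rewrite /word_inv map_rev revK -map_comp.
by rewrite -[RHS]map_id; apply: eq_map => -[q b] /=; rewrite negbK.
Qed.

Lemma as_rel_mulV (w : word) : as_rel (w ++ word_inv w) [::].
Proof.
elim: w => [|[q b] w IHw]; first exact: as_refl.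
rewrite /word_inv /= rev_cons -cats1 -/(word_inv w).
apply: as_trans (as_cancel q b).
rewrite -cat1s -[[:: _; _]]/([:: (q, b)] ++ ([::] ++ [:: (q, ~~ b)])).
apply: as_cat; first exact: as_refl.
by rewrite catA; apply: as_cat => //; apply: as_refl.
Qed.

Lemma as_rel_mulVr (w : word) : as_rel (word_inv w ++ w) [::].
Proof. by rewrite -{2}[w]word_invK; apply: as_rel_mulV. Qed.

Lemma as_rel_inv (u v : word) : as_rel u v -> as_rel (word_inv u) (word_inv v).
Proof.
move=> uv; rewrite -[word_inv u]cats0.
apply: as_trans (_ : as_rel (word_inv u ++ (v ++ word_inv v)) _).
  by apply: as_cat; [apply: as_refl | apply/as_sym/as_rel_mulV].
rewrite catA -[X in as_rel _ X]cat0s; apply: as_cat; last exact: as_refl.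
apply: as_trans (as_rel_mulVr u).
by apply: as_cat; [apply: as_refl | apply: as_sym].
Qed.

Definition as_one : As := as_class [::].
Definition as_mul (x y : As) : As := as_class (repr x ++ repr y).
Definition as_inv (x : As) : As := as_class (word_inv (repr x)).

Lemma as_mul_class u v : as_mul (as_class u) (as_class v) = as_class (u ++ v).
Proof. by apply/as_classP; apply: as_cat; apply: as_rel_repr. Qed.

Lemma as_mulA : associative as_mul.
Proof.
move=> x y z.
rewrite -[x]as_class_repr -[y]as_class_repr -[z]as_class_repr.
by rewrite !as_mul_class catA.
Qed.

Lemma as_mul1 : left_id as_one as_mul.
Proof. by move=> x; rewrite -[x]as_class_repr as_mul_class. Qed.

Lemma as_mulr1 : right_id as_one as_mul.
Proof. by move=> x; rewrite -[x]as_class_repr as_mul_class cats0. Qed.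

Lemma as_mulV : left_inverse as_one as_inv as_mul.
Proof.
move=> x; rewrite -{2}[x]as_class_repr as_mul_class.
by apply/as_classP; apply: as_rel_mulVr.
Qed.

Lemma as_mulrV : right_inverse as_one as_inv as_mul.
Proof.
move=> x; rewrite -{1}[x]as_class_repr as_mul_class.
by apply/as_classP; apply: as_rel_mulV.
Qed.

HB.instance Definition _ :=
  isGroup.Build As as_mulA as_mul1 as_mulr1 as_mulV as_mulrV.

Lemma as_mulE (u v : word) :
  (as_class u * as_class v)%g = as_class (u ++ v).
Proof. exact: as_mul_class. Qed.

Definition As_gen (q : Q) : As := as_class [:: (q, true)].

Lemma As_gen_conj (q1 q2 : Q) :
  As_gen (q1 * q2)%quandle = (As_gen q2 * As_gen q1 * (As_gen q2)^-1)%g.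
Proof.
have -> : ((As_gen q2)^-1)%g = as_class [:: (q2, false)].
  apply: (@mulgI _ (As_gen q2)); rewrite mulgV.
  rewrite as_mulE; apply/as_classP/as_sym.
  exact: (as_cancel q2 true).
rewrite (as_mulE [:: (q2, true)]) as_mulE; apply/as_classP; exact: as_conj.
Qed.

End AssociatedGroup.

Section AssociatedGroupMap.
Variables (Q Q' : quandleType) (phi : {quandle_hom Q -> Q'}).

Definition word_map (w : word Q) : word Q' := [seq (phi l.1, l.2) | l <- w].

Definition As_map (x : As Q) : As Q' := as_class (word_map (repr x)).

Lemma as_rel_map u v : as_rel u v -> as_rel (word_map u) (word_map v).
Proof.
elim=> {u v} [u|u v _ IH|u v w _ IH1 _ IH2|u u' v v' _ IH1 _ IH2|q b|q1 q2].
- exact: as_refl.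
- exact: as_sym.
- exact: as_trans IH1 IH2.
- by rewrite /word_map !map_cat; apply: as_cat.
- exact: as_cancel.
- by rewrite /word_map /= quandle_homM; apply: as_conj.
Qed.

Lemma As_map_class w : As_map (as_class w) = as_class (word_map w).
Proof. by apply/as_classP/as_rel_map/as_rel_repr. Qed.

Lemma As_mapM (x y : As Q) : As_map (x * y)%g = (As_map x * As_map y)%g.
Proof.
rewrite -[x]as_class_repr -[y]as_class_repr as_mulE !As_map_class as_mulE.
by rewrite /word_map map_cat.
Qed.

Lemma As_map_gen (q : Q) : As_map (As_gen q) = As_gen (phi q).
Proof. exact: As_map_class. Qed.

End AssociatedGroupMap.

HB.mixin Record isQQuandle (Q' : quandleType) (A : Type) of Quandle A := {
  qact : As Q' -> A -> A;
  qact1 : forall a, qact 1%g a = a;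
  qactM : forall g h a, qact (g * h)%g a = qact g (qact h a);
  qact_aut : forall g, quandle_automorphism (qact g)
}.

#[short(type="qquandleType")]
HB.structure Definition QQuandle (Q' : quandleType) :=
  {A of isQQuandle Q' A & Quandle A}.

Definition qquandle_morphism (Q' : quandleType) (A B : qquandleType Q')
    (f : A -> B) : Prop :=
  quandle_morphism f /\ forall (g : As Q') a, f (qact g a) = qact g (f a).

Section Derived.
Variables (Q Q' : quandleType) (phi : {quandle_hom Q -> Q'}).

Definition derivation (A : qquandleType Q') (d : Q -> A) : Prop :=
  forall q1 q2,
    d (q1 * q2)%quandle = (d q1 * qact (As_map phi (As_gen q1)) (d q2))%quandle.

Definition is_derived_quandle (A : qquandleType Q') (d : Q -> A) : Prop :=
  derivation d /\
  forall (B : qquandleType Q') (d' : Q -> B), derivation d' ->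
    exists! f : A -> B, qquandle_morphism f /\ f \o d = d'.

Definition derived_isomorphic (A B : qquandleType Q') (d : Q -> A) (d' : Q -> B)
    : Prop :=
  exists f : A -> B, [/\ qquandle_morphism f, bijective f & f \o d = d'].

End Derived.

(* Main.v *)
Require Import Defs.
From mathcomp Require Import all_boot.
From HB Require Import structures.
From mathcomp Require Import boolp.

(* The derived quandle is a free object: terms over the generators d q in the *)
(* operations of a Q'-quandle (product, right division, action of As(Q')),    *)
(* modulo the congruence generated by the Q'-quandle axioms and the           *)
(* derivation rule. Making division an operation turns the unique             *)
(* solvability in (Q2) into equations. Two derived quandles are isomorphic    *)
(* because the universal property forces an endomorphism fixing the           *)
(* derivation to be the identity.                                             *)

Set Implicit Arguments.
Unset Strict Implicit.
Unset Printing Implicit Defensive.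

Local Open Scope quotient_scope.
Local Open Scope quandle_scope.

(** With division as an operation, all axioms of a Q'-quandle and the derivation rule are equations,
    so terms modulo the congruence they generate form a model, generated by the image of [Q]. A
    derivation [d] into [B] evaluates terms in [B]; the generating equations hold there
    ([eval_rel]), so evaluation descends to the quotient. A Q'-homomorphism preserves division too
    ([quandle_morphism_div]), hence its value on every class is forced by its values on generators
    ([qquandle_morphism_eval]).

    For uniqueness, the comparison maps between two derived quandles compose to endomorphisms fixing
    the derivations, and these are identities ([derived_quandle_endo]). *)

Section RightDivision.
Variable Q : quandleType.

Definition qdiv (a b : Q) : Q := sval (cid (qmul_div b a)).

Lemma qdivK (a b : Q) : qdiv a b * b = a.
Proof. by rewrite /qdiv; case: cid => q [/= <-]. Qed.

Lemma qmul_injl (b : Q) : injective (fun a : Q => a * b).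
Proof.
move=> a a' /= eq_ab; have [q [_ uniq_q]] := qmul_div b (a * b).
by rewrite -(uniq_q a erefl) (uniq_q a' eq_ab).
Qed.

Lemma qmulK (a b : Q) : qdiv (a * b) b = a.
Proof. by apply: (@qmul_injl b); rewrite qdivK. Qed.

End RightDivision.

Lemma quandle_morphism_div (A B : quandleType) (f : A -> B) :
  quandle_morphism f -> forall a b, f (qdiv a b) = qdiv (f a) (f b).
Proof.
by move=> fM a b; apply: (@qmul_injl _ (f b)); rewrite /= -fM !qdivK.
Qed.

(** * Construction of the free model as a quotient of terms *)

Section DerivedQuandle.
Variables (Q Q' : quandleType) (phi : {quandle_hom Q -> Q'}).

Inductive pre_term :=
| TGen of Q
| TMul of pre_term & pre_term
| TDiv of pre_term & pre_term
| TAct of As Q' & pre_term.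

(** Classical choice supplies the structure that [{eq_quot _}] requires. *)
Definition term := {classic pre_term}.
HB.instance Definition _ := Choice.on term.

(** Of the two division rules, [rel_divK] encodes existence in (Q2) and [rel_mulK] uniqueness.
    Bijectivity of the action follows from the group laws [rel_act1] and [rel_actM]. *)
Inductive term_rel : pre_term -> pre_term -> Prop :=
| rel_refl t : term_rel t t
| rel_sym t u : term_rel t u -> term_rel u t
| rel_trans t u v : term_rel t u -> term_rel u v -> term_rel t v
| rel_mul t t' u u' :
    term_rel t t' -> term_rel u u' -> term_rel (TMul t u) (TMul t' u')
| rel_div t t' u u' :
    term_rel t t' -> term_rel u u' -> term_rel (TDiv t u) (TDiv t' u')
| rel_act g t t' : term_rel t t' -> term_rel (TAct g t) (TAct g t')
| rel_idem t : term_rel (TMul t t) t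
| rel_divK t u : term_rel (TMul (TDiv t u) u) t
| rel_mulK t u : term_rel (TDiv (TMul t u) u) t
| rel_distr t u v :
    term_rel (TMul (TMul t u) v) (TMul (TMul t v) (TMul u v))
| rel_act1 t : term_rel (TAct 1%g t) t
| rel_actM g h t : term_rel (TAct (g * h)%g t) (TAct g (TAct h t))
| rel_act_mul g t u :
    term_rel (TAct g (TMul t u)) (TMul (TAct g t) (TAct g u))
| rel_der q1 q2 :
    term_rel (TGen (q1 * q2))
             (TMul (TGen q1) (TAct (As_map phi (As_gen q1)) (TGen q2))).

Definition term_relb : rel term := fun t u => `[< term_rel t u >].

Lemma term_relb_refl : reflexive term_relb.
Proof. by move=> t; apply/asboolP; apply: rel_refl. Qed.

Lemma term_relb_sym : symmetric term_relb.
Proof. by move=> t u; apply/asboolP/asboolP; apply: rel_sym. Qed.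

Lemma term_relb_trans : transitive term_relb.
Proof.
by move=> u t v /asboolP tu /asboolP uv; apply/asboolP/(rel_trans tu uv).
Qed.

Canonical term_equiv :=
  EquivRel term_relb term_relb_refl term_relb_sym term_relb_trans.

Definition derived := {eq_quot term_equiv}.
HB.instance Definition _ := Choice.on derived.
HB.instance Definition _ := EqQuotient.on derived.

Definition class (t : pre_term) : derived := \pi_derived (t : term).

Lemma classP t u : class t = class u <-> term_rel t u.
Proof. by split=> [/eqmodP/asboolP //|tu]; apply/eqmodP/asboolP. Qed.

Lemma class_repr (x : derived) : class (repr x) = x.
Proof. exact: reprK. Qed.

Lemma rel_repr t : term_rel (repr (class t)) t.
Proof. by apply/classP; rewrite class_repr. Qed.

Lemma derived_ind (P : derived -> Prop) :
  (forall t, P (class t)) -> forall x, P x.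
Proof. by move=> Pc x; rewrite -(class_repr x). Qed.

Definition derived_mul (x y : derived) := class (TMul (repr x) (repr y)).
Definition derived_div (x y : derived) := class (TDiv (repr x) (repr y)).
Definition derived_act g (x : derived) := class (TAct g (repr x)).

Lemma derived_mulE t u : derived_mul (class t) (class u) = class (TMul t u).
Proof. by apply/classP/rel_mul; apply: rel_repr. Qed.

Lemma derived_divE t u : derived_div (class t) (class u) = class (TDiv t u).
Proof. by apply/classP/rel_div; apply: rel_repr. Qed.

Lemma derived_actE g t : derived_act g (class t) = class (TAct g t).
Proof. by apply/classP/rel_act; apply: rel_repr. Qed.

Lemma derived_inhabited : inhabited derived.
Proof. by case: (@quandle_inhabited Q) => q; exists; apply: class (TGen q). Qed.

Lemma derived_mulqq x : derived_mul x x = x.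
Proof.
by elim/derived_ind: x => t; rewrite derived_mulE; apply/classP/rel_idem.
Qed.

Lemma derived_divK x y : derived_mul (derived_div x y) y = x.
Proof.
elim/derived_ind: x => t; elim/derived_ind: y => u.
by rewrite derived_divE derived_mulE; apply/classP/rel_divK.
Qed.

Lemma derived_mulK x y : derived_div (derived_mul x y) y = x.
Proof.
elim/derived_ind: x => t; elim/derived_ind: y => u.
by rewrite derived_mulE derived_divE; apply/classP/rel_mulK.
Qed.

Lemma derived_mul_div x y : exists! z, y = derived_mul z x.
Proof.
exists (derived_div y x); split=> [|z ->]; first by rewrite derived_divK.
exact: derived_mulK.
Qed.

Lemma derived_mul_distr x y z :
  derived_mul (derived_mul x y) z =
  derived_mul (derived_mul x z) (derived_mul y z).
Proof.
elim/derived_ind: x => t; elim/derived_ind: y => u; elim/derived_ind: z => v.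
by rewrite !derived_mulE; apply/classP/rel_distr.
Qed.

HB.instance Definition _ := isQuandle.Build derived
  derived_inhabited derived_mulqq derived_mul_div derived_mul_distr.

Lemma derived_act1 x : derived_act 1%g x = x.
Proof.
by elim/derived_ind: x => t; rewrite derived_actE; apply/classP/rel_act1.
Qed.

Lemma derived_actM g h x :
  derived_act (g * h)%g x = derived_act g (derived_act h x).
Proof.
by elim/derived_ind: x => t; rewrite !derived_actE; apply/classP/rel_actM.
Qed.

Lemma derived_act_aut g : quandle_automorphism (derived_act g).
Proof.
split=> [x y|].
  elim/derived_ind: x => t; elim/derived_ind: y => u; rewrite /qmul /=.
  by rewrite derived_mulE !derived_actE derived_mulE; apply/classP/rel_act_mul.
exists (derived_act g^-1%g) => x; rewrite -derived_actM.
  by rewrite mulVg derived_act1.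
by rewrite mulgV derived_act1.
Qed.

HB.instance Definition _ := isQQuandle.Build Q' derived
  derived_act1 derived_actM derived_act_aut.

Definition derived_gen (q : Q) : derived := class (TGen q).

Lemma derived_gen_derivation : derivation phi derived_gen.
Proof.
move=> q1 q2; rewrite /qmul /qact /= derived_actE derived_mulE.
exact/classP/rel_der.
Qed.

(** * Universal property via evaluation of terms *)

Section Universal.
Variables (B : qquandleType Q') (d : Q -> B).

Fixpoint eval (t : pre_term) : B :=
  match t with
  | TGen q => d q
  | TMul t u => eval t * eval u
  | TDiv t u => qdiv (eval t) (eval u)
  | TAct g t => qact g (eval t)
  end.

(** Each rule is an identity valid in [B]; only [rel_der] uses that [d] is a derivation. This makes
    [derived_lift] independent of the chosen representative. *)
Lemma eval_rel : derivation phi d ->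
  forall t u, term_rel t u -> eval t = eval u.
Proof.
move=> d_der t u; elim=> {t u} //=.
- by move=> t u v _ -> _ ->.
- by move=> t t' u u' _ -> _ ->.
- by move=> t t' u u' _ -> _ ->.
- by move=> g t t' _ ->.
- by move=> t; rewrite qmulqq.
- by move=> t u; rewrite qdivK.
- by move=> t u; rewrite qmulK.
- by move=> t u v; rewrite qmul_distr.
- by move=> t; rewrite qact1.
- by move=> g h t; rewrite qactM.
- by move=> g t u; rewrite (proj1 (qact_aut g)).
Qed.

Definition derived_lift (x : derived) : B := eval (repr x).

Lemma derived_liftE : derivation phi d ->
  forall t, derived_lift (class t) = eval t.
Proof. by move=> d_der t; apply/eval_rel/rel_repr. Qed.

Lemma derived_lift_morphism :
  derivation phi d -> qquandle_morphism derived_lift.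
Proof.
move=> d_der; split=> [x y|g x]; elim/derived_ind: x => t.
  elim/derived_ind: y => u.
  by rewrite {1}/qmul /= derived_mulE !derived_liftE.
by rewrite {1}/qact /= derived_actE !derived_liftE.
Qed.

Lemma qquandle_morphism_eval (f : derived -> B) :
  qquandle_morphism f -> f \o derived_gen = d ->
  forall t, f (class t) = eval t.
Proof.
move=> [fM fact] fd; elim=> [q|t IHt u IHu|t IHt u IHu|g t IHt] /=.
- by rewrite -fd.
- by rewrite -derived_mulE -IHt -IHu -fM.
- rewrite -IHt -IHu -quandle_morphism_div // -derived_divE.
  (* The abstract [qdiv] on [derived] agrees with [derived_div]: multiplying either on the right by
     [class u] gives [class t]. *)
  congr f; apply: (@qmul_injl _ (class u)).
  by rewrite /= qdivK; apply: derived_divK.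
- by rewrite -derived_actE -IHt -fact.
Qed.

End Universal.

Lemma derived_universal : is_derived_quandle phi derived_gen.
Proof.
split=> [|B d d_der]; first exact: derived_gen_derivation.
exists (derived_lift d); split=> [|f [f_morph fd]].
  split; first exact: derived_lift_morphism.
  by apply/funext => q /=; rewrite derived_liftE.
apply/funext => x; elim/derived_ind: x => t.
by rewrite derived_liftE // (qquandle_morphism_eval f_morph fd).
Qed.

End DerivedQuandle.

(** * Uniqueness up to isomorphism *)

Lemma qquandle_morphism_comp (Q' : quandleType) (A B C : qquandleType Q')
    (f : B -> C) (g : A -> B) :
  qquandle_morphism f -> qquandle_morphism g -> qquandle_morphism (f \o g).
Proof.
by move=> [fM fact] [gM gact]; split=> [x y|h x] /=; rewrite ?gM ?gact.
Qed.

(** Both [f] and [id] factor [d] through itself, so the uniqueness clause identifies them. *)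
Lemma derived_quandle_endo (Q Q' : quandleType) (phi : {quandle_hom Q -> Q'})
    (A : qquandleType Q') (d : Q -> A) (f : A -> A) :
  is_derived_quandle phi d -> qquandle_morphism f -> f \o d = d -> f = id.
Proof.
move=> [d_der univ] f_morph fd; have [h [_ h_uniq]] := univ A d d_der.
by rewrite -(h_uniq f) // (h_uniq id).
Qed.

Theorem theorem3p3 (Q Q' : quandleType) (phi : {quandle_hom Q -> Q'}) :
  (exists (A : qquandleType Q') (d : Q -> A), is_derived_quandle phi d) /\
  (forall (A B : qquandleType Q') (d : Q -> A) (d' : Q -> B),
     is_derived_quandle phi d -> is_derived_quandle phi d' ->
     derived_isomorphic d d').
Proof.
split.
  by exists (derived phi), (derived_gen phi); apply: derived_universal.
move=> A B d d' dA dB.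
have [f [[f_morph fd] _]] := dA.2 B d' dB.1.
have [g [[g_morph gd] _]] := dB.2 A d dA.1.
exists f; split=> //; exists g.
  have gf: g \o f = id.
    apply: (derived_quandle_endo dA); first exact: qquandle_morphism_comp.
    by rewrite -compA fd.
  by move=> x; rewrite -[LHS]/((g \o f) x) gf.
have fg: f \o g = id.
  apply: (derived_quandle_endo dB); first exact: qquandle_morphism_comp.
  by rewrite -compA gd.
by move=> x; rewrite -[LHS]/((f \o g) x) fg.
Qed.
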